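(* Let $f:\mathbb{R}^n\to\mathbb{R}$ and $g:\mathbb{R}^m\to\mathbb{R}$ be continuously differentiable and convex, let $A\in\mathbb{R}^{m\times n}$ with $m\ge n$ have full column rank, let $r\ge3$ and $t_0>0$, and let $V(x)=f(x)+g(Ax)$ with $\operatorname{argmin}V\neq\emptyset$. Let $X^\star\in\mathcal{O}$, for some open set $\mathcal{O}\subseteq\mathbb{R}^n$, be a local minimizer of $V$ satisfying $$V(X)-V(X^\star)\ge\phi(\|X-X^\star\|)\qquad\text{for all }X\in\mathcal{O},$$ where $\phi:[0,\infty)\to[0,\infty)$ is a forcing function, i.e., for any sequence $\{\xi_k\}\subset[0,\infty)$, $\lim_{k\to\infty}\phi(\xi_k)=0$ implies $\lim_{k\to\infty}\xi_k=0$. Then $Y^\star=(X^\star,0)$ is an asymptotically stable critical point of the dynamical system on $\mathbb{R}^n\times\mathbb{R}^n$ $$\frac{d}{dt}\begin{pmatrix} Y_1 \\ Y_2 \end{pmatrix}=\begin{pmatrix} Y_2 \\ -\tfrac{r}{t}Y_2-(A^TA)^{-1}\nabla V(Y_1) \end{pmatrix},\qquad t\ge t_0,$$ which, with $Y_1=X$ and $Y_2=\dot X$, is equivalent to the A-ADMM flow $\ddot X+\frac{r}{t}\dot X+(A^TA)^{-1}\nabla V(X)=0$.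
   Context: $\|\cdot\|$ is the Euclidean norm. For a dynamical system $\dot Y=F(Y,t)$, $Y(t_0)=Y_0$, with $Y(t)\in\mathbb{R}^p$, a point $Y^\star$ with $F(Y^\star,t)=0$ for all $t\ge t_0$ is called a critical point. A critical point $Y^\star$ is stable if for every neighborhood $\mathcal{N}\subseteq\mathbb{R}^p$ of $Y^\star$ there is a neighborhood $\bar{\mathcal{N}}\subseteq\mathcal{N}$ of $Y^\star$ such that every solution $Y(t)$ with initial condition $Y(t_0)=Y_0\in\bar{\mathcal{N}}$ is defined (i.e. its maximal forward extension is defined) and remains in $\mathcal{N}$ for all $t>t_0$. It is asymptotically stable if it is stable and, additionally, the neighborhood $\bar{\mathcal{N}}$ can be chosen so that $\lim_{t\to\infty}Y(t)=Y^\star$ for all $Y_0\in\bar{\mathcal{N}}$. *)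

(* Defs.v *)
From HB Require Import structures.
From mathcomp Require Export all_boot all_order all_algebra.
From mathcomp Require Export all_classical all_reals all_analysis.

Set Implicit Arguments.
Unset Strict Implicit.
Unset Printing Implicit Defensive.

Import Order.TTheory GRing.Theory Num.Theory.
Import numFieldNormedType.Exports.

Local Open Scope classical_set_scope.
Local Open Scope ring_scope.

(* The library norm on matrices is the max norm. *)
Definition enorm (R : realType) (n : nat) (x : 'cV[R]_n) : R :=
  Num.sqrt (\sum_(i < n) x i 0 ^+ 2).

Definition gradient (R : realType) (n : nat) (f : 'cV[R]_n -> R)
    (x : 'cV[R]_n) : 'cV[R]_n :=
  \col_(i < n) 'D_(delta_mx i 0) f x.

Definition continuously_differentiable (R : realType) (n : nat)
    (f : 'cV[R]_n -> R) : Prop :=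
  (forall x, differentiable f x) /\ continuous (gradient f).

Definition argmin (R : realType) (T : Type) (f : T -> R) : set T :=
  [set x | forall y, f x <= f y].

Definition local_minimizer (R : realType) (T : topologicalType)
    (f : T -> R) (x : T) : Prop :=
  \forall y \near x, f x <= f y.

(* Functions [0, oo) -> [0, oo) are represented by functions R -> R whose
   values at negative arguments are irrelevant. *)
Definition forcing_function (R : realType) (phi : R -> R) : Prop :=
  (forall s, 0 <= s -> 0 <= phi s) /\
  (forall xi : nat -> R, (forall k, 0 <= xi k) ->
     phi (xi k) @[k --> \oo] --> (0 : R) -> xi k @[k --> \oo] --> (0 : R)).

Section dynamical_systems.
Context {R : realType} {E : normedModType R}.
Implicit Types (F : E -> R -> E) (T : \bar R) (Y : R -> E).

Definition forward_itv (t0 : R) T : set R := [set t | t0 <= t /\ (t%:E < T)%E].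

(* The difference quotient is restricted to D, so that the derivative is
   one-sided at an endpoint of an interval D. *)
Definition has_derivative_on (D : set R) Y (dY : R -> E) : Prop :=
  forall t, D t ->
    (s - t)^-1 *: (Y s - Y t) @[s --> within D t^'] --> dY t.

Definition solution F (t0 : R) T Y : Prop :=
  has_derivative_on (forward_itv t0 T) Y (fun t => F (Y t) t).

(* The maximal forward extensions of the solutions issued from time t0. *)
Definition maximal_solution F (t0 : R) T Y : Prop :=
  [/\ (t0%:E < T)%E,
      solution F t0 T Y &
      forall T' Z, (T < T')%E -> solution F t0 T' Z ->
        ~ (forall t, forward_itv t0 T t -> Z t = Y t)].

Definition critical_point F (t0 : R) (Ys : E) : Prop :=
  forall t, t0 <= t -> F Ys t = 0.

(* Solutions need not be unique: every maximal solution is considered. *)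
Definition solutions_remain F (t0 : R) (N0 N : set E) : Prop :=
  forall T Y, maximal_solution F t0 T Y -> N0 (Y t0) ->
    T = +oo%E /\ (forall t, t0 < t -> N (Y t)).

Definition solutions_converge F (t0 : R) (N0 : set E) (Ys : E) : Prop :=
  forall T Y, maximal_solution F t0 T Y -> N0 (Y t0) ->
    Y t @[t --> +oo] --> Ys.

Definition stable F (t0 : R) (Ys : E) : Prop :=
  forall N, nbhs Ys N ->
    exists N0, [/\ nbhs Ys N0, N0 `<=` N & solutions_remain F t0 N0 N].

Definition asymptotically_stable F (t0 : R) (Ys : E) : Prop :=
  stable F t0 Ys /\
  forall N, nbhs Ys N ->
    exists N0, [/\ nbhs Ys N0, N0 `<=` N, solutions_remain F t0 N0 N &
      solutions_converge F t0 N0 Ys].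

End dynamical_systems.

Definition admm_field (R : realType) (m n : nat) (A : 'M[R]_(m, n)) (r : R)
    (V : 'cV[R]_n -> R) (Y : 'cV[R]_n * 'cV[R]_n) (t : R) :
    'cV[R]_n * 'cV[R]_n :=
  (Y.2, - (r / t) *: Y.2 - invmx (A^T *m A) *m gradient V Y.1).

(* X solves the second-order equation on [t0, T) with velocity dX. *)
Definition admm_flow (R : realType) (m n : nat) (A : 'M[R]_(m, n)) (r : R)
    (V : 'cV[R]_n -> R) (t0 : R) (T : \bar R) (X dX : R -> 'cV[R]_n) : Prop :=
  has_derivative_on (forward_itv t0 T) X dX /\
  exists ddX : R -> 'cV[R]_n,
    has_derivative_on (forward_itv t0 T) dX ddX /\
    forall t, forward_itv t0 T t ->
      ddX t + (r / t) *: dX t + invmx (A^T *m A) *m gradient V (X t) = 0.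

(* Main.v *)
From HB Require Import structures.
Require Import Defs.
From mathcomp Require Import ring lra.

(* Any curve of the system dissipates E = V(X) - V(Xs) + |AX'|^2 / 2.
   Convexity spreads the forcing inequality from O to the whole space, so the
   sublevel sets of E shrink to (Xs, 0) and are forward invariant: this is
   stability.  A solution confined to such a set has bounded velocity; if it
   lived only up to a finite time it would have a limit there, from which Peano's
   theorem would continue it.  Since r >= 3, the function
   t^2 (V(X) - V(Xs)) + |A((r - 1)(X - Xs) + tX')|^2 / 2 is nonincreasing too;
   hence V(X) - V(Xs) = O(1/t^2), so that X -> Xs, and, X being bounded,
   X' = O(1/t). *)

Set Implicit Arguments.
Unset Strict Implicit.
Unset Printing Implicit Defensive.

Import Order.TTheory GRing.Theory Num.Theory.
Import numFieldNormedType.Exports.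

Local Open Scope classical_set_scope.
Local Open Scope ring_scope.

(** The gradient of [V] is only continuous, so trajectories may fail to be unique; stability
    quantifies over every maximal solution and asks that [T = +oo]. A maximal solution that stops
    can only be refuted by exhibiting an extension, hence the need for an existence theorem under
    mere continuity. All other estimates hold along any given curve. The mechanical energy alone
    does not give convergence: its derivative [- (r / t) |AX'|^2] vanishes wherever the velocity
    does and carries a factor that fades with time. The second function supplies a rate instead.
    Velocities are measured through [A] because [A^T A] then cancels the inverse in the force and
    leaves the plain pairing with the gradient; full column rank converts bounds on [A u] back into
    bounds on [u]. A forcing function need be neither monotone nor continuous, so no explicit
    modulus can be read off it: small values of [V(X) - V(Xs)] are turned into closeness to [Xs] by
    contradiction, on sequences. *)

(** * Derivatives relative to a set and the mean value inequality *)

Section ode.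
Context {R : realType} {E : normedModType R}.
Implicit Types (Y dY : R -> E) (D : set R).

(** Little-o form without division, in which [s = t] needs no exclusion; derivatives of sums, pairs
    and glued curves then reduce to norm estimates. *)
Lemma has_derivative_onP D Y dY :
  has_derivative_on D Y dY <->
  forall t, D t -> forall e, 0 < e -> \forall s \near t, D s ->
    `|Y s - Y t - (s - t) *: dY t| <= e * `|s - t|.
Proof.
split=> [H t Dt e e0|H t Dt].
- have /cvgrPdist_le/(_ e e0) := H t Dt.
  rewrite /dnbhs !near_withinE.
  apply: filterS => s Hs Ds.
  have [->|st] := eqVneq s t; first by rewrite !subrr scale0r subrr !normr0 mulr0.
  have st0 : s - t != 0 by rewrite subr_eq0.
  have -> : Y s - Y t - (s - t) *: dY t =
            (s - t) *: ((s - t)^-1 *: (Y s - Y t) - dY t).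
    by rewrite scalerBr scalerA divff// scale1r.
  by rewrite normrZ mulrC ler_wpM2r// distrC; exact: Hs.
- apply/cvgrPdist_le => e e0; rewrite /dnbhs !near_withinE.
  move: (H t Dt e e0); apply: filterS => s Hs st Ds; move: (Hs Ds).
  have st0 : s - t != 0 by rewrite subr_eq0.
  have -> : Y s - Y t - (s - t) *: dY t =
            (s - t) *: ((s - t)^-1 *: (Y s - Y t) - dY t).
    by rewrite scalerBr scalerA divff// scale1r.
  by rewrite normrZ mulrC ler_pM2r ?normr_gt0// distrC.
Qed.

Lemma has_derivative_on_continuous D Y dY t : has_derivative_on D Y dY -> D t ->
  Y s @[s --> within D (nbhs t)] --> Y t.
Proof.
move=> /has_derivative_onP H Dt; apply/cvgrPdist_le => e e0.
rewrite near_withinE.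
have C0 : 0 < 1 + `|dY t| by rewrite ltr_pwDl.
near=> s => Ds.
have Hs : `|Y s - Y t - (s - t) *: dY t| <= 1 * `|s - t|.
  by move: Ds; near: s; exact: H.
have st : `|s - t| <= e / (1 + `|dY t|).
  rewrite distrC; near: s.
  by apply: cvgr_dist_le; [exact: cvg_id | rewrite divr_gt0].
rewrite distrC -(subrK ((s - t) *: dY t) (Y s - Y t)).
rewrite (le_trans (ler_normD _ _))//.
rewrite (le_trans (lerD Hs (lexx _)))// normrZ mulrC -mulrDr.
by rewrite -ler_pdivlMr.
Unshelve. all: by end_near. Qed.

Lemma mean_value_inequality0 D Y dY (e a b : R) :
  has_derivative_on D Y dY -> a <= b -> (forall t, a <= t <= b -> D t) ->
  (forall t, a <= t < b -> `|dY t| <= e) -> `|Y b - Y a| <= e * (b - a).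
Proof.
move=> HY ab abD dYe.
(* The slack [e' - e] will absorb the little-o remainder when the bound is pushed beyond the
   supremum [c] of the times where it holds. *)
suff He e' : e < e' -> `|Y b - Y a| <= e' * (b - a).
  move: ab; rewrite le_eqVlt => /predU1P[<-|ab].
    by rewrite !subrr normr0 mulr0.
  rewrite -ler_pdivrMr ?subr_gt0//; apply/ler_addgt0Pr => z z0.
  by rewrite ler_pdivrMr ?subr_gt0//; apply: He; rewrite ltrDl.
move=> ee'.
pose S := [set t | a <= t <= b /\ `|Y t - Y a| <= e' * (t - a)].
have Sa : S a by split; rewrite ?lexx ?ab// !subrr normr0 mulr0.
have hS : has_sup S by split; [exists a | exists b => x [/andP[]]].
pose c := sup S.
have ac : a <= c by apply: ub_le_sup => //; case: hS.
have cb : c <= b by apply: ge_sup; [exists a | move=> x [/andP[]]].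
have cab : a <= c <= b by rewrite ac.
(* The supremum is attained: the bound passes from points of [S] close to [c] by continuity of [Y].
   The factor [1 + |e'|] is used since the sign of [e'] is unknown. *)
have Sc : S c.
  split=> //; apply/ler_addgt0Pr => d d0.
  have K0 : 0 < 1 + `|e'| by rewrite ltr_pwDl.
  have d20 : 0 < d / 2 by rewrite divr_gt0.
  have /cvgrPdist_le/(_ _ d20) := has_derivative_on_continuous HY (abD _ cab).
  rewrite near_withinE => /nbhs_ballP[r /= r0 Hr].
  have m0 : 0 < Num.min r (d / 2 / (1 + `|e'|)) by rewrite lt_min r0 divr_gt0.
  have [x Sx xc] := sup_adherent m0 hS.
  have xc' : x <= c by apply: ub_le_sup => //; case: hS.
  have : c - x < Num.min r (d / 2 / (1 + `|e'|)) by rewrite ltrBlDr addrC -ltrBlDr.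
  rewrite lt_min => /andP[cxr cxd].
  have Yxc : `|Y c - Y x| <= d / 2.
    apply: Hr; first by rewrite /ball/= ger0_norm// subr_ge0.
    by apply: abD; case: Sx.
  have [_ Hx] := Sx.
  rewrite (le_trans (ler_distD (Y x) _ _))// (le_trans (lerD Yxc Hx))//.
  have : - (e' * (c - x)) <= d / 2.
    rewrite (@le_trans _ _ (`|e'| * (c - x)))//.
      by rewrite -mulNr ler_wpM2r ?subr_ge0// -normrN ler_norm.
    rewrite (@le_trans _ _ ((1 + `|e'|) * (c - x)))//.
      by rewrite ler_wpM2r ?subr_ge0// lerDr.
    by rewrite mulrC -ler_pdivlMr// ltW.
  by lra.
suff <- : c = b by case: Sc.
apply/eqP; rewrite eq_le cb/= leNgt; apply/negP => ltcb.
move/has_derivative_onP: HY => /(_ c (abD _ cab)) HY.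
have e'e0 : 0 < e' - e by rewrite subr_gt0.
have /nbhs_ballP[r /= r0 Hr] := HY _ e'e0.
pose s := Num.min b (c + r / 2).
have cs : c < s by rewrite lt_min ltcb/= ltrDl divr_gt0.
have sab : a <= s <= b by rewrite ge_min lexx (le_trans ac (ltW cs)).
suff : s <= c by rewrite leNgt cs.
apply: ub_le_sup; first by case: hS.
split=> //.
have : `|Y s - Y c - (s - c) *: dY c| <= (e' - e) * `|s - c|.
  apply: Hr; last exact: abD.
  rewrite /ball/= ltr0_norm ?subr_lt0// opprB ltrBlDl gt_min.
  by apply/orP; right; rewrite ltrD2l gtr_pMr// invf_lt1// ltr1n.
rewrite (gtr0_norm (x := s - c)) ?subr_gt0// => H1.
have H2 : `|Y s - Y c| <= e' * (s - c).
  rewrite -(subrK ((s - c) *: dY c) (Y s - Y c)) (le_trans (ler_normD _ _))//.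
  rewrite (_ : e' * (s - c) = (e' - e) * (s - c) + e * (s - c)); last by ring.
  rewrite lerD// normrZ gtr0_norm ?subr_gt0// mulrC ler_wpM2r ?subr_ge0 ?(ltW cs)//.
  by apply: dYe; rewrite ac.
rewrite (le_trans (ler_distD (Y c) _ _))//.
case: Sc => _ H3; rewrite (le_trans (lerD H2 H3))//.
by rewrite -mulrDr (_ : s - c + (c - a) = s - a)//; ring.
Qed.

Lemma mean_value_inequality D Y dY (v : E) (e a b : R) :
  has_derivative_on D Y dY -> a <= b -> (forall t, a <= t <= b -> D t) ->
  (forall t, a <= t < b -> `|dY t - v| <= e) ->
  `|Y b - Y a - (b - a) *: v| <= e * (b - a).
Proof.
move=> HY ab abD dYv.
have shift s t : Y s - s *: v - (Y t - t *: v) = Y s - Y t - (s - t) *: v.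
  by rewrite scalerBl !opprB addrACA [RHS]addrACA [- _ - _]addrC.
rewrite -shift.
apply: (@mean_value_inequality0 D (fun t => Y t - t *: v) (fun t => dY t - v)) => //.
apply/has_derivative_onP => t Dt d d0.
move/has_derivative_onP: HY => /(_ t Dt d d0).
apply: filterS => s Hs /Hs.
by rewrite shift scalerBr opprB addrA subrK.
Qed.

End ode.

(** * Euler polygons and Peano's existence theorem *)

Section euler.
Context {R : realType} {E : normedModType R}.
Variable G : E -> R -> E.

Fixpoint euler (t0 : R) (y0 : E) (h : R) (j : nat) : E :=
  if j is i.+1 then
    euler t0 y0 h i + h *: G (euler t0 y0 h i) (t0 + i%:R * h)
  else y0.

(** Discrete mean value inequality. With [v = 0] it gives the uniform Lipschitz bound on polygons;
    with [v] the field at a limit point it becomes the differential equation. *)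
Lemma euler_straddle t0 y0 h v e i j : 0 <= h -> (i <= j)%N ->
  (forall l, (i <= l < j)%N ->
    `|G (euler t0 y0 h l) (t0 + l%:R * h) - v| <= e) ->
  `|euler t0 y0 h j - euler t0 y0 h i - ((j - i)%:R * h) *: v|
    <= (j - i)%:R * h * e.
Proof.
move=> h0; elim: j => [|j IH].
  by rewrite leqn0 => /eqP-> _; rewrite subrr subnn !mul0r scale0r subrr normr0.
rewrite leq_eqVlt => /predU1P[-> _|].
  by rewrite subrr subnn !mul0r scale0r subrr normr0.
rewrite ltnS => ij Hv.
have {}IH : `|euler t0 y0 h j - euler t0 y0 h i - ((j - i)%:R * h) *: v|
    <= (j - i)%:R * h * e.
  by apply: IH => // l /andP[il lj]; apply: Hv; rewrite il ltnW.
rewrite subSn// -natr1 !mulrDl mul1r /= scalerDl.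
set x := euler _ _ _ _; set g := G _ _.
have -> : x + h *: g - euler t0 y0 h i - (((j - i)%:R * h) *: v + h *: v) =
  (x - euler t0 y0 h i - ((j - i)%:R * h) *: v) + h *: (g - v).
  by rewrite scalerBr opprD (addrAC x) addrACA.
rewrite (le_trans (ler_normD _ _))// lerD// normrZ ger0_norm// ler_wpM2l//.
by apply: Hv; rewrite ij/=.
Qed.

End euler.

(** Stands in for the extraction of a convergent subsequence: a cluster point of an ultrafilter is a
    limit, because each set or its complement belongs to the ultrafilter. *)
Lemma ultrafilter_cvg (R : realType) (E : normedModType R) (I : Type)
    (U : set_system I) (u : I -> E) (C : R) :
  UltraFilter U -> compact [set z : E | `|z| <= C] ->
  (\forall k \near U, `|u k| <= C) -> exists p : E, u k @[k --> U] --> p.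
Proof.
move=> UU cC uC.
have [p [_ up]] := cC (fmap u U) _ uC.
exists p => A Ap; have [//|] := in_ultra_setVsetC (u @^-1` A) UU.
by move=> uA; have [x []] := up (~` A) A uA Ap.
Qed.

Section peano.
Context {R : realType} {E : normedModType R}.
Variables (F : E -> R -> E) (t0 : R) (y0 : E).
Hypothesis cE : forall C, compact [set z : E | `|z| <= C].
Hypothesis cF : forall (y : E) (t : R), t0 <= t ->
  F p.1 p.2 @[p --> (y, t)] --> F y t.

Lemma near_field y t (e : R) : t0 <= t -> 0 < e -> exists2 d : R, 0 < d &
  forall z s, `|z - y| < d -> `|s - t| < d -> `|F z s - F y t| < e.
Proof.
move=> t0t e0; have /cvgrPdist_lt/(_ e e0) := @cF y t t0t.
move=> /nbhs_ballP[d /= d0 Hd]; exists d => // z s zy st.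
rewrite distrC; apply: (Hd (z, s)).
by split=> /=; rewrite -ball_normE /ball_ /= distrC.
Qed.

(** [N x] counts the whole steps of length [h] between [t0] and [x]. Both rounding errors lie
    between 0 and [h], so their difference in the last bound is at most [h], not [2 h]. *)
Lemma truncn_step (h s t : R) : 0 < h -> t0 <= s -> s <= t ->
  let N x := Num.truncn ((x - t0) / h) in
  [/\ (N s <= N t)%N, (N t)%:R * h <= t - t0, s - t0 - h <= (N s)%:R * h &
   `|t - s - (N t - N s)%:R * h| <= h].
Proof.
move=> h0 t0s st N.
have Nle : (N s <= N t)%N by apply: le_truncn; rewrite ler_pM2r ?invr_gt0// lerB.
have HN x : t0 <= x -> (N x)%:R * h <= x - t0 < (N x)%:R * h + h.
  move=> t0x; have : 0 <= (x - t0) / h by rewrite divr_ge0 ?subr_ge0// ltW.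
  move=> /truncn_itv/andP[]; rewrite ler_pdivlMr// ltr_pdivrMr//.
  rewrite -natr1 -/(N x) mulrDl mul1r.
  by move=> -> ->.
have /andP[s1 s2] := HN s t0s; have /andP[t1 t2] := HN t (le_trans t0s st).
split=> //; first by lra.
by rewrite natrB// mulrBl ler_norml; apply/andP; split; lra.
Qed.

(* The Euler polygons, read as step functions of time, converge pointwise along
   an ultrafilter; the estimate of euler_straddle survives the limit and is the
   differential equation.  F is truncated to 0 away from (y0, t0) so that the
   polygons are bounded. *)
Lemma peano : exists2 d : R, 0 < d & exists2 Y : R -> E, Y t0 = y0 &
  solution F t0 (t0 + d)%:E Y.
Proof.
have [r r0 Hr] := near_field y0 (lexx t0) (@ltr01 R).
pose G y t := if (`|y - y0| < r) && (`|t - t0| < r) then F y t else 0.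
(* [M] bounds [G] by the choice of [r]; the summand 1 also ensures [1 <= M], so that time lags are
   dominated by the corresponding displacement bounds. *)
pose M := `|F y0 t0| + 1.
have M1 : 1 <= M by rewrite lerDr.
have M0 : 0 <= M by rewrite (le_trans _ M1).
have GM y t : `|G y t| <= M.
  rewrite /G; case: ifPn => [/andP[yr tr]|_]; last by rewrite normr0.
  rewrite -(subrK (F y0 t0) (F y t)) (le_trans (ler_normD _ _))// addrC lerD2l.
  exact/ltW/Hr.
pose h (k : nat) : R := k.+1%:R^-1.
have h0 k : 0 < h k by rewrite invr_gt0 ltr0n.
pose N k t := Num.truncn ((t - t0) / h k).
pose x k := euler G t0 y0 (h k).
pose X k t := x k (N k t).
have lipx k i j : (i <= j)%N -> `|x k j - x k i| <= (j - i)%:R * h k * M.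
  move=> ij; have := @euler_straddle _ _ G t0 y0 (h k) 0 M _ _ (ltW (h0 k)) ij.
  by rewrite scaler0 subr0; apply=> l _; rewrite subr0.
(* A single ultrafilter serves all times at once, so neither a diagonal extraction nor
   equicontinuity is invoked to define the limit. *)
have [U [UU ooU]] := ultraFilterLemma (@eventually_filter).
have hU : h k @[k --> U] --> (0 : R).
  have := @cvg_harmonic R; apply: cvg_trans => A; exact: ooU.
have N0 k : N k t0 = 0%N by rewrite /N subrr mul0r truncn0.
have XB k t : t0 <= t -> `|X k t - y0| <= (t - t0) * M.
  move=> t0t; have [_ Nt _ _] := truncn_step (h0 k) t0t (lexx _).
  have := lipx k 0%N (N k t) (leq0n _); rewrite subn0 => /le_trans; apply.
  by rewrite ler_wpM2r.
have /choice[Y HY] : forall t : R, exists p : E,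
    t0 <= t -> X k t @[k --> U] --> p.
  move=> t; have [t0t|_] := leP t0 t; last by exists y0.
  have [|p Hp] := @ultrafilter_cvg _ E _ U (X ^~ t) ((t - t0) * M + `|y0|) UU
    (@cE _).
    apply: nearW => k; rewrite -(subrK y0 (X k t)) (le_trans (ler_normD _ _))//.
    by rewrite lerD2r XB.
  by exists p.
have YB t : t0 <= t -> `|Y t - y0| <= (t - t0) * M.
  move=> t0t; have Hl : `|X k t - y0| @[k --> U] --> `|Y t - y0|.
    by apply: cvg_norm; apply: cvgB; [exact: HY | exact: cvg_cst].
  by apply: (ler_cvg_to Hl (cvg_cst _)); apply: nearW => k; exact: XB.
have Nh a b : t0 <= a -> a <= b -> (N k b - N k a)%:R * h k @[k --> U] --> b - a.
  move=> t0a ab; apply/cvgrPdist_le => e e0.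
  have : \forall k \near U, `|h k| <= e by exact: cvgr0_norm_le.
  apply: filterS => k hk.
  have [_ _ _] := truncn_step (h0 k) t0a ab; move=> /le_trans; apply.
  by rewrite (le_trans _ hk)// ler_norm.
(* The time [t] may be either end of the interval, which covers difference quotients on both sides.
   For the polygon to stay within [rho] of [Y t], half of [rho] goes to [X k t - Y t], a quarter to
   the displacement over the interval and a quarter to the rounding by [h k]. *)
have key a b t v e rho : t0 <= a -> a <= t -> t <= b -> 0 < rho -> 
    (forall z s, `|z - Y t| < rho -> `|s - t| < rho -> `|G z s - v| <= e) ->
    (b - a) * M < rho / 4 -> `|Y b - Y a - (b - a) *: v| <= (b - a) * e.
  move=> t0a at_ tb rho0 HG bar.
  have ab := le_trans at_ tb.
  have t0t := le_trans t0a at_.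
  have HL : `|X k b - X k a - ((N k b - N k a)%:R * h k) *: v| @[k --> U]
      --> `|Y b - Y a - (b - a) *: v|.
    apply: cvg_norm; apply: cvgB.
      by apply: cvgB; apply: HY => //; exact: le_trans ab.
    by apply: cvgZl; exact: Nh.
  have HR : (N k b - N k a)%:R * h k * e @[k --> U] --> (b - a) * e.
    by apply: cvgMl; exact: Nh.
  apply: (ler_cvg_to HL HR).
  have Xt : \forall k \near U, `|X k t - Y t| < rho / 2.
    have r2 : 0 < rho / 2 by rewrite divr_gt0.
    by have /cvgrPdist_lt/(_ _ r2) := HY t t0t; apply: filterS => k; rewrite distrC.
  have hk : \forall k \near U, h k * M < rho / 4.
    have r4 : 0 < rho / 4 / M by rewrite !divr_gt0// (lt_le_trans _ M1).
    have : \forall k \near U, `|h k| < rho / 4 / M by exact: cvgr0_norm_lt.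
    apply: filterS => k.
    by rewrite gtr0_norm// ltr_pdivlMr// (lt_le_trans _ M1).
  near=> k.
  have Xkt : `|X k t - Y t| < rho / 2 by near: k.
  have hkr : h k * M < rho / 4 by near: k.
  have [Nab Nb Na Nba] := truncn_step (h0 k) t0a ab.
  have [Nat _ _ _] := truncn_step (h0 k) t0a at_.
  have [Ntb _ _ _] := truncn_step (h0 k) t0t tb.
  have NM : (N k b - N k a)%:R * h k * M < rho / 2.
    have : (N k b - N k a)%:R * h k * M <= (b - a + h k) * M.
      by rewrite ler_wpM2r//; move: Nba; rewrite ler_norml => /andP[]; lra.
    by lra.
  have near_t l : (N k a <= l <= N k b)%N -> `|x k l - X k t| < rho / 2.
    move=> /andP[al lb]; apply: le_lt_trans NM.
    have [tl|lt] := leqP (N k t) l.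
      rewrite (le_trans (lipx _ _ _ tl))// ler_wpM2r// ler_wpM2r ?(ltW (h0 k))//.
      by rewrite ler_nat leq_sub.
    rewrite distrC (le_trans (lipx _ _ _ (ltnW lt)))// ler_wpM2r//.
    rewrite ler_wpM2r ?(ltW (h0 k))//.
    by rewrite ler_nat leq_sub.
  apply: euler_straddle => //; first exact: ltW.
  move=> l /andP[al lb]; apply: HG.
    rewrite (le_lt_trans (ler_distD (X k t) _ _))//.
    by have := near_t l; rewrite al ltnW//= => /(_ isT); lra.
  have l1 : (N k a)%:R * h k <= l%:R * h k by rewrite ler_pM2r// ler_nat.
  have l2 : l%:R * h k <= (N k b)%:R * h k by rewrite ler_pM2r// ler_nat ltnW.
  have M2 : h k <= h k * M by rewrite ler_peMr// ltW.
  have M3 : b - a <= (b - a) * M by rewrite ler_peMr// subr_ge0.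
  by rewrite ltr_norml; apply/andP; split; lra.
have M10 : 0 < M + 1 by rewrite ltr_wpDl.
(* This length keeps both [t - t0] and [(t - t0) * M] below [r], so the truncation in [G] is never
   felt. *)
exists (r / (M + 1)); first by rewrite divr_gt0.
exists Y.
  apply/eqP; rewrite -subr_eq0 -normr_le0.
  by have := YB t0 (lexx _); rewrite subrr mul0r.
apply/has_derivative_onP => t [t0t tr] e e0.
move: tr; rewrite lte_fin -ltrBlDl ltr_pdivlMr// => tr.
have tM : t - t0 <= (t - t0) * M by rewrite ler_peMr// subr_ge0.
have tM0 : 0 <= (t - t0) * M by rewrite mulr_ge0// subr_ge0.
have [d d0 Hd] := near_field (Y t) t0t e0.
(* The second term keeps the [rho]-neighbourhood of [(Y t, t)] inside the region where [G] equals
   [F]. *)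
pose rho := Num.min d (r - (t - t0) * M).
have rho0 : 0 < rho by rewrite lt_min d0/= subr_gt0; lra.
have HG z s : `|z - Y t| < rho -> `|s - t| < rho -> `|G z s - F (Y t) t| <= e.
  rewrite !lt_min => /andP[zd zr] /andP[sd sr].
  rewrite /G ifT; first exact/ltW/Hd.
  apply/andP; split.
    rewrite (le_lt_trans (ler_distD (Y t) _ _))//.
    by have := YB t t0t; lra.
  rewrite (le_lt_trans (ler_distD t _ _))// (ger0_norm (x := t - t0)) ?subr_ge0//.
  by lra.
apply/nbhs_ballP; exists (rho / 4 / (M + 1)); rewrite /= ?divr_gt0// => s.
rewrite /ball/= ltr_pdivlMr// => ts [t0s _].
have Mts : `|t - s| * M < rho / 4 by apply: le_lt_trans ts; rewrite ler_wpM2l// lerDl.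
have [st|ts'] := leP s t.
- move: Mts; rewrite (ger0_norm (x := t - s)) ?subr_ge0// => Mts.
  have -> : Y s - Y t - (s - t) *: F (Y t) t =
      - (Y t - Y s - (t - s) *: F (Y t) t).
    by rewrite -scaleNr opprB [RHS]opprB [in RHS]opprB [RHS]addrC.
  rewrite normrN (distrC s) (ger0_norm (x := t - s)) ?subr_ge0// mulrC.
  exact: (key s t t _ _ rho).
- move: Mts; rewrite distrC (gtr0_norm (x := s - t)) ?subr_gt0// => Mts.
  rewrite mulrC.
  by apply: (key t s t _ _ rho) => //; exact: ltW.
Unshelve. all: by end_near. Qed.
End peano.

(** * Continuation of solutions with bounded velocity *)

(** The delicate point is the junction [T]: the glued curve needs derivative [F p T] there from the
    left as well. This comes from the mean value inequality on [[s, b]] as [b] tends to [T], since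
    the field along [Y] tends to [F p T]. *)
Lemma maximal_solution_pinfty (R : realType) (E : normedModType R)
    (F : E -> R -> E) (t0 : R) (T : \bar R) (Y : R -> E) (M : R) :
  (forall C, compact [set z : E | `|z| <= C]) ->
  (forall (y : E) (t : R), t0 <= t -> F p.1 p.2 @[p --> (y, t)] --> F y t) ->
  maximal_solution F t0 T Y ->
  (forall t, forward_itv t0 T t -> `|F (Y t) t| <= M) -> T = +oo%E.
Proof.
move=> cE cF [t0T sY maxY] FM.
case: T => [T| |] // in t0T sY maxY FM *; exfalso.
rewrite lte_fin in t0T.
have itv t : forward_itv t0 T%:E t <-> t0 <= t < T.
  by split=> [[? ?]|/andP[? ?]]; [apply/andP|split].
have M0 : 0 <= M by apply: le_trans (FM t0 _); [|apply/itv; rewrite lexx].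
have M1 : 0 < M + 1 by rewrite ltr_wpDl.
have lipY a b : t0 <= a -> a <= b -> b < T -> `|Y b - Y a| <= M * (b - a).
  move=> t0a ab bT; apply: (mean_value_inequality0 sY) => //.
    by move=> t /andP[a_t tb]; apply/itv; rewrite (le_trans t0a)//= (le_lt_trans tb).
  move=> t /andP[a_t tb]; apply: FM.
  by apply/itv; rewrite (le_trans t0a)//= (lt_trans tb).
have nearT : \forall b \near T^'-, t0 < b < T.
  near=> b; apply/andP; split; near: b; last exact: nbhs_left_lt.
  exact: nbhs_left_gt.
have [U [UU TU]] := ultraFilterLemma (@at_left_proper_filter R T).
have [|p Yp] := @ultrafilter_cvg _ E _ U Y (M * (T - t0) + `|Y t0|) UU (@cE _).
  apply: TU; apply: filterS nearT => b /andP[t0b bT].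
  rewrite -(subrK (Y t0) (Y b)) (le_trans (ler_normD _ _))// lerD2r.
  rewrite (le_trans (lipY _ _ _ (ltW t0b) bT))// ler_wpM2l// lerD2r.
  exact: ltW.
(* The limit [p] is so far known only along the ultrafilter; this estimate makes it a genuine left
   limit. *)
have Ypl a : t0 <= a < T -> `|Y a - p| <= M * (T - a).
  move=> /andP[t0a aT].
  have Hl : `|Y a - Y b| @[b --> U] --> `|Y a - p|.
    by apply: cvg_norm; apply: cvgB => //; exact: cvg_cst.
  apply: (ler_cvg_to Hl (cvg_cst _)); apply: TU.
  near=> b.
  have ab : a <= b by apply: ltW; near: b; exact: nbhs_left_gt.
  have bT : b < T by near: b; exact: nbhs_left_lt.
  rewrite distrC (le_trans (lipY _ _ t0a ab bT))// ler_wpM2l// lerD2r.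
  exact: ltW.
have YTp : Y b @[b --> T^'-] --> p.
  apply/cvgrPdist_le => e e0; near=> b.
  have t0b : t0 < b by near: b; exact: nbhs_left_gt.
  have bT : b < T by near: b; exact: nbhs_left_lt.
  rewrite distrC (le_trans (Ypl b _))//; first by rewrite (ltW t0b).
  have : T - e / (M + 1) < b.
    by near: b; apply: nbhs_left_gt; rewrite ltrBlDr ltrDl divr_gt0.
  rewrite ltrBlDr -ltrBlDl ltr_pdivlMr// => /ltW; apply: le_trans.
  by rewrite mulrC ler_wpM2l ?subr_ge0 ?(ltW bT)// lerDl.
have cFT y t : T <= t -> F p.1 p.2 @[p --> (y, t)] --> F y t.
  by move=> Tt; apply: cF; rewrite (le_trans (ltW t0T)).
have [d d0 [Z ZT sZ]] := @peano _ E F T p cE cFT.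
(* At [T] the value is [Z T = p]: a solution on the half-open interval leaves [Y T]
   unconstrained. *)
pose W t := if t < T then Y t else Z t.
apply: (maxY (T + d)%:E W); rewrite ?lte_fin ?ltrDl//; last first.
  by move=> t /itv/andP[_ tT]; rewrite /W tT.
apply/has_derivative_onP => t [t0t]; rewrite lte_fin => tTd e e0.
rewrite /W; case: ltP => [tT|Tt].
  have sT : \forall s \near t, s < T by exact: lt_nbhsl.
  have Dt : forward_itv t0 T%:E t by split.
  move/has_derivative_onP: sY => /(_ t Dt e e0).
  apply: filterS2 sT => s sT Hs [t0s _]; rewrite sT.
  by apply: Hs; apply/itv; rewrite t0s.
have right : \forall s \near t, T <= s < T + d ->
    `|Z s - Z t - (s - t) *: F (Z t) t| <= e * `|s - t|.
  have DZ : forward_itv T (T + d)%:E t by split.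
  move/has_derivative_onP: sZ => /(_ t DZ e e0); apply: filterS => s Hs /andP[Ts sTd].
  by apply: Hs; split.
suff left : \forall s \near t, t0 <= s < T ->
    `|Y s - Z t - (s - t) *: F (Z t) t| <= e * `|s - t|.
  near=> s => -[t0s]; rewrite lte_fin => sTd; case: ltP => sT.
    by have : t0 <= s < T; [rewrite t0s | near: s].
  by have : T <= s < T + d; [rewrite sT | near: s].
move: Tt; rewrite le_eqVlt => /predU1P[<-|Tt]; last first.
  have : \forall s \near t, T < s by exact: lt_nbhsr.
  by apply: filterS => s Ts /andP[_]; rewrite ltNge (ltW Ts).
rewrite ZT.
have [r r0 Hr] := @near_field _ E F t0 cF p T e (ltW t0T) e0.
apply/nbhs_ballP; exists (r / (M + 1)); rewrite /= ?divr_gt0// => s.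
rewrite /ball/= => + /andP[t0s sT].
rewrite gtr0_norm ?subr_gt0// ltr_pdivlMr// => sr.
have Ts0 : 0 < T - s by rewrite subr_gt0.
rewrite (distrC s) gtr0_norm//.
have -> : Y s - p - (s - T) *: F p T = - (p - Y s - (T - s) *: F p T).
  by rewrite -scaleNr opprB [RHS]opprB [in RHS]opprB [RHS]addrC.
rewrite normrN.
have bT : b @[b --> T^'-] --> T by apply: cvg_at_left_filter; exact: cvg_id.
have HL : `|Y b - Y s - (b - s) *: F p T| @[b --> T^'-] -->
    `|p - Y s - (T - s) *: F p T|.
  apply: cvg_norm; apply: cvgB.
    by apply: cvgB => //; exact: cvg_cst.
  by apply: cvgZl; apply: cvgB => //; exact: cvg_cst.
have HR : e * (b - s) @[b --> T^'-] --> e * (T - s).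
  by apply: cvgMr; apply: cvgB => //; exact: cvg_cst.
apply: (ler_cvg_to HL HR).
near=> b.
have sb : s <= b by apply: ltW; near: b; exact: nbhs_left_gt.
have {}bT : b < T by near: b; exact: nbhs_left_lt.
apply: (mean_value_inequality sY) => //.
  by move=> u /andP[su ub]; apply/itv; rewrite (le_trans t0s su)/= (le_lt_trans ub).
move=> u /andP[su ub].
have uT := lt_trans ub bT.
have Tu : T - u <= T - s by rewrite lerD2l lerN2.
apply/ltW/Hr.
  rewrite (le_lt_trans (Ypl u _))//; first by rewrite uT (le_trans t0s).
  rewrite (le_lt_trans _ sr)// mulrC (@le_trans _ _ ((T - s) * M))//.
    by rewrite ler_wpM2r.
  by rewrite ler_wpM2l ?(ltW Ts0)// lerDl.
rewrite distrC gtr0_norm ?subr_gt0// (le_lt_trans Tu)// (le_lt_trans _ sr)//.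
by rewrite ler_peMr ?(ltW Ts0)// lerDr.
Unshelve. all: by end_near. Qed.

(** * Continuity and compactness for the max norm *)

Section matrix_norm.
Context {R : realType}.

Lemma mx_norm_le m n (x : 'M[R]_(m, n)) c :
  0 <= c -> (forall i j, `|x i j| <= c) -> `|x| <= c.
Proof.
move=> c0 xc; rewrite [leLHS]/Num.norm /= mx_normrE.
by apply/bigmax_leP; split=> // -[i j] _; exact: xc.
Qed.

Lemma mx_entry_le m n (x : 'M[R]_(m, n)) i j : `|x i j| <= `|x|.
Proof.
rewrite [leRHS]/Num.norm /= mx_normrE.
by apply/bigmax_geP; right; exists (i, j).
Qed.

Lemma mulmx_continuous m n p (M : 'M[R]_(m, n)) :
  continuous (mulmx M : 'M[R]_(n, p) -> 'M[R]_(m, p)).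
Proof.
pose f : {linear 'M[R]_(n, p) -> 'M[R]_(m, p)} := mulmx M.
apply/(@linear_bounded_continuous _ _ _ f)/linear_boundedP.
near=> r => x; apply: mx_norm_le => [|i j].
  by rewrite mulr_ge0//; near: r; exact: nbhs_pinfty_ge.
rewrite !mxE (le_trans (ler_norm_sum _ _ _))//.
apply: (@le_trans _ _ (\sum_(k < n) `|M i k| * `|x|)).
  by apply: ler_sum => k _; rewrite normrM ler_wpM2l// mx_entry_le.
rewrite -mulr_suml ler_wpM2r//.
apply: (@le_trans _ _ (\sum_i \sum_(k < n) `|M i k|)).
  by rewrite (bigD1 i)//= lerDl sumr_ge0// => l _; rewrite sumr_ge0.
by near: r; apply: nbhs_pinfty_ge; exact: num_real.
Unshelve. all: by end_near. Qed.

Lemma trmx_continuous m n :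
  continuous (trmx : 'M[R]_(m, n) -> 'M[R]_(n, m)).
Proof.
pose f : {linear 'M[R]_(m, n) -> 'M[R]_(n, m)} := trmx.
apply/(@linear_bounded_continuous _ _ _ f)/linear_boundedP.
near=> r => x; apply: mx_norm_le => [|i j].
  by rewrite mulr_ge0//; near: r; exact: nbhs_pinfty_ge.
rewrite mxE (le_trans (mx_entry_le _ _ _))// ler_peMl//.
Unshelve. all: by end_near. Qed.

(** The closed bounded criterion is applied to row vectors and carried over by transposition, which
    does not increase the max norm. *)
Lemma compact_cV_ball n (C : R) : compact [set x : 'cV[R]_n | `|x| <= C].
Proof.
have cB : compact [set x : 'rV[R]_n | `|x| <= C].
  apply: bounded_closed_compact.
    exists C; split; first exact: num_real.
    by move=> y Cy x /= xC; exact: le_trans (ltW Cy).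
  have := @closed_closed_ball_ _ _ (0 : 'rV[R]_n) C.
  by congr closed; apply/seteqP; split=> x; rewrite /closed_ball_ /= sub0r normrN.
have trC p q (x : 'M[R]_(p, q)) : `|x^T| <= `|x|.
  by apply: mx_norm_le => // i j; rewrite mxE mx_entry_le.
have := continuous_compact (continuous_subspaceT (@trmx_continuous 1 n)) cB.
congr compact; apply/seteqP; split=> [_ [x xC <-]|x xC] /=.
  exact: le_trans (trC _ _ _) xC.
by exists x^T; rewrite ?trmxK//=; exact: le_trans (trC _ _ _) xC.
Qed.

Lemma compact_prod_ball (E F : normedModType R) (C : R) :
  compact [set x : E | `|x| <= C] -> compact [set y : F | `|y| <= C] ->
  compact [set z : E * F | `|z| <= C].
Proof.
move=> cE cF; have := compact_setX cE cF.
congr compact; apply/seteqP; split=> -[x y] /=; rewrite prod_normE ge_max /=.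
  by move=> [-> ->].
by move=> /andP[].
Qed.

End matrix_norm.

(** * Inner product and gradients *)

Section gradient.
Context {R : realType}.

Definition dotv n (u v : 'cV[R]_n) : R := \sum_i u i 0 * v i 0.

Lemma dotvDl n (u v w : 'cV[R]_n) : dotv (u + v) w = dotv u w + dotv v w.
Proof. by rewrite /dotv -big_split; apply: eq_bigr => i _; rewrite !mxE mulrDl. Qed.

Lemma dotvC n (u v : 'cV[R]_n) : dotv u v = dotv v u.
Proof. by apply: eq_bigr => i _; rewrite mulrC. Qed.

Lemma dotvZl n c (u w : 'cV[R]_n) : dotv (c *: u) w = c * dotv u w.
Proof. by rewrite /dotv mulr_sumr; apply: eq_bigr => i _; rewrite !mxE mulrA. Qed.

Lemma dotvDr n (u v w : 'cV[R]_n) : dotv w (u + v) = dotv w u + dotv w v.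
Proof. by rewrite dotvC dotvDl !(dotvC w). Qed.

Lemma dotvZr n c (u w : 'cV[R]_n) : dotv w (c *: u) = c * dotv w u.
Proof. by rewrite dotvC dotvZl (dotvC w). Qed.

Lemma dotvv_ge0 n (u : 'cV[R]_n) : 0 <= dotv u u.
Proof. by apply: sumr_ge0 => i _; rewrite -expr2 sqr_ge0. Qed.

Lemma normr_dotvv n (u : 'cV[R]_n) : `|u| ^+ 2 <= dotv u u.
Proof.
rewrite -[leRHS]sqr_sqrtr ?dotvv_ge0// ler_pXn2r// ?nnegrE ?sqrtr_ge0//.
apply: mx_norm_le; rewrite ?sqrtr_ge0// => i j.
rewrite -sqrtr_sqr ler_wsqrtr// (ord1 j) /dotv (bigD1 i)//= expr2 lerDl sumr_ge0//.
by move=> k _; rewrite -expr2 sqr_ge0.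
Qed.

Lemma dotv_mulmxl m n (A : 'M[R]_(m, n)) u v :
  dotv (A *m u) v = dotv u (A^T *m v).
Proof.
have dotvE k (x y : 'cV[R]_k) : dotv x y = (x^T *m y) 0 0.
  by rewrite mxE; apply: eq_bigr => i _; rewrite mxE.
by rewrite !dotvE trmx_mul mulmxA.
Qed.

Lemma diff_gradient n (f : 'cV[R]_n -> R) x v : differentiable f x ->
  'd f x v = dotv (gradient f x) v.
Proof.
move=> df.
rewrite [in LHS](matrix_sum_delta v) linear_sum /=; apply: eq_bigr => i _.
by rewrite big_ord1 linearZ/= mxE -deriveE// mulrC.
Qed.

Lemma differentiable_mulmx m n (A : 'M[R]_(m, n)) (x : 'cV[R]_n) :
  differentiable (mulmx A : _ -> 'cV[R]_m) x.
Proof. apply: linear_differentiable; exact: mulmx_continuous. Qed.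

Lemma diff_mulmx m n (A : 'M[R]_(m, n)) (x v : 'cV[R]_n) :
  'd (mulmx A : _ -> 'cV[R]_m) x v = A *m v.
Proof. by rewrite diff_lin//; exact: mulmx_continuous. Qed.

Lemma gradient_comp_mulmx m n (f : 'cV[R]_n -> R) (g : 'cV[R]_m -> R)
    (A : 'M[R]_(m, n)) x : differentiable f x -> differentiable g (A *m x) ->
  differentiable (fun x => f x + g (A *m x)) x /\
  gradient (fun x => f x + g (A *m x)) x =
  gradient f x + A^T *m gradient g (A *m x).
Proof.
move=> df dg.
have dA := differentiable_mulmx A x.
have dgA : differentiable (g \o mulmx A) x by exact: differentiable_comp.
have dV : differentiable (f + (g \o mulmx A)) x by exact: differentiableD.
split=> //; apply/matrixP => i j; rewrite (ord1 j) !mxE.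
rewrite (_ : (fun x => _) = f + (g \o mulmx A))// deriveD; try exact: diff_derivable.
congr +%R; rewrite deriveE// diff_comp//= diff_mulmx diff_gradient//.
rewrite -colE; apply: eq_bigr => k _; first by rewrite !mxE mulrC.
Qed.

Lemma continuously_differentiable_comp m n (f : 'cV[R]_n -> R)
    (g : 'cV[R]_m -> R) (A : 'M[R]_(m, n)) :
  continuously_differentiable f -> continuously_differentiable g ->
  continuously_differentiable (fun x => f x + g (A *m x)).
Proof.
move=> [df cf] [dg cg]; split=> [x|].
  by have [] := gradient_comp_mulmx (df x) (dg (A *m x)).
rewrite (_ : gradient _ = fun x => gradient f x + A^T *m gradient g (A *m x)).
  move=> x; apply: (@cvgD _ _ _ _ _ (gradient f) _ _ _ (cf x)).
  apply: (@continuous_comp _ _ _ (fun x => gradient g (A *m x)) (mulmx A^T));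
    last exact: mulmx_continuous.
  apply: (@continuous_comp _ _ _ (mulmx A) (gradient g)); last exact: cg.
  exact: mulmx_continuous.
by apply/funext => x; have [] := gradient_comp_mulmx (df x) (dg (A *m x)).
Qed.

End gradient.

(** * Convexity, minimizers and the forcing condition *)

Section convex.
Context {R : realType}.

Lemma convex_functionE (E : lmodType R) (f : E -> R) :
  convex_function (E := E) [set: E] f <->
  forall t x y, 0 <= t <= 1 ->
    f (t *: x + (1 - t) *: y) <= t * f x + (1 - t) * f y.
Proof.
split=> [cf t x y /andP[t0 t1]|cf t x y _ _].
  exact: (cf (Itv01 t0 t1) x y (mem_set I) (mem_set I)).
by apply: cf; rewrite ge0/= le1.
Qed.

Lemma derive_cvg_at_right (E : normedModType R) (f : E -> R) x v :
  derivable f x v ->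
  h^-1 * (f (h *: v + x) - f x) @[h --> 0^'+] --> 'D_v f x.
Proof. by move=> dfv; apply: cvg_dnbhs_at_right; exact: dfv. Qed.

(** By convexity, the difference quotients from [x] towards [y] with step at most 1 never exceed
    [f y - f x]. *)
Lemma convex_derive (E : normedModType R) (f : E -> R) x y :
  convex_function (E := E) [set: E] f -> differentiable f x ->
  f x + 'd f x (y - x) <= f y.
Proof.
move=> /convex_functionE cf df.
have dfv := @diff_derivable _ _ _ f x (y - x) df.
rewrite -lerBrDl -deriveE//.
apply: (ler_cvg_to (derive_cvg_at_right dfv) (cvg_cst _)); near=> h.
have h0 : 0 < h by near: h; exact: nbhs_right_gt.
have h1 : h <= 1 by near: h; exact: nbhs_right_le.
have -> : h *: (y - x) + x = h *: y + (1 - h) *: x.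
  by rewrite scalerBr scalerBl scale1r -addrA [- _ + x]addrC.
rewrite ler_pdivrMl//.
have := cf h y x; rewrite (ltW h0) h1 => /(_ isT); lra.
Unshelve. all: by end_near. Qed.

Lemma convex_function_comp m n (f : 'cV[R]_n -> R) (g : 'cV[R]_m -> R)
    (A : 'M[R]_(m, n)) :
  convex_function (E := 'cV[R]_n) [set: 'cV[R]_n] f ->
  convex_function (E := 'cV[R]_m) [set: 'cV[R]_m] g ->
  convex_function (E := 'cV[R]_n) [set: 'cV[R]_n] (fun x => f x + g (A *m x)).
Proof.
move=> /convex_functionE cf /convex_functionE cg; apply/convex_functionE => t x y t01.
rewrite mulmxDr -!scalemxAr.
have := cf t x y t01; have := cg t (A *m x) (A *m y) t01; lra.
Qed.

Lemma convex_local_minimizer (E : normedModType R) (f : E -> R) x :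
  convex_function (E := E) [set: E] f -> local_minimizer f x ->
  forall y, f x <= f y.
Proof.
move=> /convex_functionE cf fx y.
have lx : h *: y + (1 - h) *: x @[h --> (0 : R)^'+] --> x.
  have h0 : h @[h --> (0 : R)^'+] --> (0 : R).
    by apply: cvg_at_right_filter; exact: cvg_id.
  rewrite [X in _ --> X](_ : x = 0 *: y + (1 - 0) *: x).
    apply: cvgD; apply: cvgZl => //.
    by apply: cvgB => //; exact: cvg_cst.
  by rewrite scale0r add0r subr0 scale1r.
have Hx : \forall h \near (0 : R)^'+, f x <= f (h *: y + (1 - h) *: x).
  exact: (lx _ fx).
near (0 : R)^'+ => h.
have h0 : 0 < h by near: h; exact: nbhs_right_gt.
have h1 : h <= 1 by near: h; exact: nbhs_right_le.
have : f x <= f (h *: y + (1 - h) *: x) by near: h.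
have := cf h y x; rewrite (ltW h0) h1 => /(_ isT) H1 H2.
by rewrite -subr_ge0 -(pmulr_rge0 _ h0); lra.
Unshelve. all: by end_near. Qed.

Lemma gradient_minimizer n (f : 'cV[R]_n -> R) x :
  differentiable f x -> (forall y, f x <= f y) -> gradient f x = 0.
Proof.
move=> df fx.
have ge0 v : 0 <= 'D_v f x.
  have dfv := @diff_derivable _ _ _ f x v df.
  apply: (ler_cvg_to (cvg_cst _) (derive_cvg_at_right dfv)); near=> h.
  have h0 : 0 < h by near: h; exact: nbhs_right_gt.
  by rewrite mulr_ge0 ?invr_ge0 ?(ltW h0)// subr_ge0.
apply/matrixP => i j; rewrite !mxE; apply/eqP; rewrite eq_le ge0 andbT.
by have := ge0 (- delta_mx i 0); rewrite !deriveE// linearN oppr_ge0.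
Unshelve. all: by end_near. Qed.

(** If it failed, points with vanishing gap but at distance at least [rho] could be moved onto one
    fixed sphere inside [O] without increasing the gap; [phi] would then force distances to 0 on a
    sphere of positive radius. *)
Lemma forcing_sublevel n (V : 'cV[R]_n -> R) (O : set 'cV[R]_n) x phi :
  convex_function (E := 'cV[R]_n) [set: 'cV[R]_n] V ->
  (forall y, V x <= V y) -> open O -> O x -> forcing_function phi ->
  (forall y, O y -> phi (enorm (y - x)) <= V y - V x) ->
  forall rho, 0 < rho -> exists2 e, 0 < e &
    forall y, V y - V x < e -> `|y - x| < rho.
Proof.
move=> /convex_functionE cV Vx oO Ox [phi0 phi_force] HO rho rho0.
have /nbhs_ballP[d /= d0 Hd] : nbhs x O by exact: open_nbhs_nbhs.
(* [d / 2] places the sphere inside [O]; [rho] makes every [u k] lie on or outside it, so that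
   [s k <= 1]. *)
pose r := Num.min rho (d / 2).
have r0 : 0 < r by rewrite lt_min rho0 divr_gt0.
apply/not_exists2P => H.
have /choice[u Hu] : forall k : nat, exists y,
    [/\ V y - V x < k.+1%:R^-1 & rho <= `|y - x|].
  move=> k; have [[]|] := H k.+1%:R^-1; first by rewrite invr_gt0 ltr0n.
  by move=> /existsNP[y /not_implyP[? /negP]]; rewrite -leNgt => ?; exists y.
pose s k := r / `|u k - x|.
have un0 k : 0 < `|u k - x| by have [_ /(lt_le_trans rho0)] := Hu k.
have s01 k : 0 <= s k <= 1.
  rewrite divr_ge0 ?(ltW r0)//= ler_pdivrMr// mul1r.
  by have [_] := Hu k; apply: le_trans; rewrite ge_min lexx.
(* u k is pulled back along its segment to the sphere of radius r around x. *)
pose w k := s k *: u k + (1 - s k) *: x.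
have wx k : w k - x = s k *: (u k - x).
  by rewrite /w scalerBl scale1r addrCA addrAC subrr add0r scalerBr.
have nw k : `|w k - x| = r.
  rewrite wx normrZ ger0_norm; last by case/andP: (s01 k).
  by rewrite divfK// gt_eqF.
have Ow k : O (w k).
  apply: Hd; rewrite -ball_normE /ball_ /= distrC nw gt_min; apply/orP; right.
  by rewrite gtr_pMr// invf_lt1// ltr1n.
have Vw k : V (w k) - V x <= k.+1%:R^-1.
  have [uk _] := Hu k; have /andP[s0 s1] := s01 k.
  have := cV (s k) (u k) x (s01 k); rewrite -/(w k) => Hc.
  have : s k * (V (u k) - V x) <= 1 * (V (u k) - V x).
    by rewrite ler_wpM2r// subr_ge0.
  move: uk Hc; clearbody w; move: (s k) (k.+1%:R^-1) => a b; lra.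
have e0 k : 0 <= enorm (w k - x) by exact: sqrtr_ge0.
have : phi (enorm (w k - x)) @[k --> \oo] --> (0 : R).
  apply: (@squeeze_cvgr _ _ _ _ (cst 0) (fun k => k.+1%:R^-1)).
  - by apply: nearW => k; rewrite phi0//= (le_trans (HO _ (Ow k))).
  - exact: cvg_cst.
  - exact: cvg_harmonic.
move=> /(phi_force _ e0)/cvgr0_norm_lt/(_ r r0)[N _ /(_ N (leqnn N))] /=.
rewrite ger0_norm// ltNge -(nw N) => /negP; apply.
(* The sphere is taken in the max norm while [phi] receives Euclidean distances, which are at least
   as large. *)
rewrite -(ler_pXn2r (n := 2))// ?nnegrE// sqr_sqrtr.
  apply: (le_trans (normr_dotvv _)); rewrite le_eqVlt; apply/orP; left; apply/eqP.
  by apply: eq_bigr => i _; rewrite expr2.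
by apply: sumr_ge0 => i _; exact: sqr_ge0.
Qed.

End convex.

(** * Differentiation along curves *)

Section curves.
Context {R : realType}.

Lemma has_derivative_on_pair (E F : normedModType R) (D : set R)
    (Y dY : R -> E * F) : has_derivative_on D Y dY <->
  has_derivative_on D (fun t => (Y t).1) (fun t => (dY t).1) /\
  has_derivative_on D (fun t => (Y t).2) (fun t => (dY t).2).
Proof.
split=> [/has_derivative_onP H|[/has_derivative_onP H1 /has_derivative_onP H2]].
  split; apply/has_derivative_onP => t Dt e e0;
    have := H t Dt e e0; apply: filterS => s Hs /Hs;
    by rewrite prod_normE ge_max => /andP[].
apply/has_derivative_onP => t Dt e e0.
have := H1 t Dt e e0; have := H2 t Dt e e0; apply: filterS2 => s Hs2 Hs1 Ds.
by rewrite prod_normE ge_max Hs1// Hs2.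
Qed.

(** Gives access to the usual rules of calculus at interior times; the initial time enters the
    energy argument through continuity only. *)
Lemma has_derivative_on_is_derive (E : normedModType R) (D : set R)
    (Y dY : R -> E) t :
  has_derivative_on D Y dY -> nbhs t D -> is_derive t 1 Y (dY t).
Proof.
move=> /has_derivative_onP H nD.
have q : h^-1 *: ((Y \o shift t) (h *: 1) - Y t) @[h --> 0^'] --> dY t.
  apply/cvgrPdist_le => e e0; rewrite near_withinE.
  have /(filterI nD)/nbhs_ballP[d /= d0 Hd] := H t (nbhs_singleton nD) e e0.
  apply/nbhs_ballP; exists d => //= h; rewrite /ball/= sub0r normrN => hd h0.
  have bh : ball t d (h + t) by rewrite /ball/= opprD addrCA subrr addr0 normrN.
  have [Dh /(_ Dh)] := Hd _ bh.
  rewrite addrK => He.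
  rewrite distrC (_ : h%:A = h); last by rewrite /GRing.scale/= mulr1.
  have -> : h^-1 *: (Y (h + t) - Y t) - dY t = h^-1 *: (Y (h + t) - Y t - h *: dY t).
    by rewrite [RHS]scalerBr scalerA mulVf// scale1r.
  by rewrite normrZ normfV ler_pdivrMl ?normr_gt0// mulrC.
apply: DeriveDef; first by apply/cvg_ex; exists (dY t).
exact: cvg_lim.
Qed.

Lemma is_derive_diff_comp (E F : normedModType R) (Phi : E -> F) (X : R -> E)
    (t : R) (dX : E) : is_derive t 1 X dX -> differentiable Phi (X t) ->
  is_derive t 1 (Phi \o X) ('d Phi (X t) dX).
Proof.
move=> [dvX <-] dPhi; have /derivable1_diffP dfX := dvX.
have dc : differentiable (Phi \o X) t by exact: differentiable_comp.
apply: DeriveDef; first exact/derivable1_diffP.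
by rewrite !deriveE// diff_comp.
Qed.

Lemma is_derive_scale (E : normedModType R) (a : R -> R) (Y : R -> E) (t da : R)
    (dY : E) : is_derive t 1 a da -> is_derive t 1 Y dY ->
  is_derive t 1 (fun s => a s *: Y s) (da *: Y t + a t *: dY).
Proof.
move=> [va <-] [vY <-].
have st : shift t (h *: 1) @[h --> (0 : R)^'] --> t.
  rewrite -[X in _ --> X]add0r -[X in _ --> X + _](scale0r (1 : R^o)).
  apply: cvgD; last exact: cvg_cst.
  by apply: cvgZl; apply: cvg_within_filter; exact: cvg_id.
have cY : Y (shift t (h *: 1)) @[h --> (0 : R)^'] --> Y t.
  have cYt : {for t, continuous Y}.
    by apply: differentiable_continuous; exact/derivable1_diffP.
  exact: (@cvg_comp _ _ _ (fun h => shift t (h *: 1)) Y _ _ _ st cYt).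
have q : h^-1 *: (((fun s => a s *: Y s) \o shift t) (h *: 1) - a t *: Y t)
    @[h --> 0^'] --> 'D_1 a t *: Y t + a t *: 'D_1 Y t.
  rewrite [X in X @ _ --> _](_ : _ = fun h =>
      (h^-1 *: ((a \o shift t) (h *: 1) - a t)) *: Y (shift t (h *: 1)) +
      a t *: (h^-1 *: ((Y \o shift t) (h *: 1) - Y t))).
    by apply: cvgD; [apply: cvgZ => // | apply: cvgZr].
  apply/funext => h /=.
  rewrite -[_ *: (_ - a t)]/(_ * _) -scalerA scalerBl.
  rewrite (scalerA (a t)) mulrC -scalerA -scalerDr; congr (_ *: _).
  by rewrite scalerBr addrA subrK.
apply: DeriveDef; first by apply/cvg_ex; eexists; exact: q.
exact: cvg_lim.
Qed.

Lemma is_derive_dotvv n (U : R -> 'cV[R]_n) (t : R) dU :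
  is_derive t 1 U dU ->
  is_derive t 1 (fun s => dotv (U s) (U s)) (2 * dotv (U t) dU).
Proof.
move=> HU.
have Hi (i : 'I_n) : is_derive t 1 (fun s => U s i 0) (dU i 0).
  have := is_derive_diff_comp HU (differentiable_coord (U t) i 0).
  set c := (fun N : 'cV[R]_n => N i 0 : R).
  have lin_c : linear c by move=> a u v; rewrite /c !mxE.
  pose cL : {linear 'cV[R]_n -> R} := HB.pack c (GRing.isLinear.Build _ _ _ _ c lin_c).
  by rewrite (@diff_lin _ _ _ cL)//; exact: coord_continuous.
have := is_derive_sum (fun i => is_deriveM (Hi i) (Hi i)).
rewrite fct_sumE => H; apply: is_derive_eq.
rewrite /dotv mulr_sumr; apply: eq_bigr => i _ /=.
by rewrite /GRing.scale/=; ring.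
Qed.

Lemma dotvv_cvg n (I : Type) (G : set_system I) (u : I -> 'cV[R]_n) l :
  Filter G -> u s @[s --> G] --> l ->
  dotv (u s) (u s) @[s --> G] --> dotv l l.
Proof.
move=> FG ul; rewrite /dotv; apply: (@cvg_big _ _ +%R) => [|i _].
  exact: add_continuous.
have ui : u s i 0 @[s --> G] --> l i 0.
  apply: (@cvg_comp _ _ _ u (fun N : 'cV[R]_n => N i 0) G _ _ ul).
  exact: coord_continuous.
exact: cvgM.
Qed.

End curves.

(** * The family of energies and its derivative *)

Section energy.
Context {R : realType} {m n : nat}.
Variables (A : 'M[R]_(m, n)) (V : 'cV[R]_n -> R) (Xs : 'cV[R]_n).

(* a = 1, b = 0 is the mechanical energy; a = t, b = r - 1 is, up to a factor,
   the Lyapunov function of Su, Boyd and Candes. *)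
Definition energy (a b : R) (y : 'cV[R]_n * 'cV[R]_n) : R :=
  let u := A *m (b *: (y.1 - Xs) + a *: y.2) in
  a ^+ 2 * (V y.1 - V Xs) + 2^-1 * dotv u u.

Lemma energy_cvg (I : Type) (G : set_system I) (a : I -> R)
    (y : I -> 'cV[R]_n * 'cV[R]_n) (la b : R) ly :
  Filter G -> continuous V -> a s @[s --> G] --> la -> y s @[s --> G] --> ly ->
  energy (a s) b (y s) @[s --> G] --> energy la b ly.
Proof.
move=> FG cV al yl.
have y1 : (y s).1 @[s --> G] --> ly.1 by apply: (cvg_comp _ _ yl); exact: cvg_fst.
have y2 : (y s).2 @[s --> G] --> ly.2 by apply: (cvg_comp _ _ yl); exact: cvg_snd.
apply: cvgD.
  apply: cvgM; first by rewrite !expr2; apply: cvgM.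
  apply: cvgB; last exact: cvg_cst.
  by apply: (cvg_comp _ _ y1); exact: cV.
apply: cvgMr; apply: dotvv_cvg.
apply: (@cvg_comp _ _ _ _ (mulmx A) _
  (nbhs (b *: (ly.1 - Xs) + la *: ly.2))); last exact: mulmx_continuous.
apply: cvgD; last exact: cvgZ.
by apply: cvgZr; apply: cvgB => //; exact: cvg_cst.
Qed.

(** Pairing [A *m u] with [A] times the force gives minus the pairing of [u] with the gradient. The
    velocity part of [u] thereby cancels the derivative of [V] along the curve, and only its
    [b *: (X - Xs)] part still meets the gradient. *)
Lemma energy_is_derive (X dX : R -> 'cV[R]_n) (al : R -> R) (dal b r t : R) :
  A^T *m A \in unitmx -> 0 < t -> differentiable V (X t) ->
  is_derive t 1 X (dX t) ->
  is_derive t 1 dX (- (r / t) *: dX t - invmx (A^T *m A) *m gradient V (X t)) ->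
  is_derive t 1 al dal ->
  is_derive t 1 (fun s => energy (al s) b (X s, dX s))
    (2 * al t * dal * (V (X t) - V Xs)
     - al t * b * dotv (gradient V (X t)) (X t - Xs)
     + (b + dal - al t * (r / t)) *
       dotv (A *m (b *: (X t - Xs) + al t *: dX t)) (A *m dX t)).
Proof.
move=> Bu t0 dV HX HdX Hal.
set g := gradient V (X t); set B := A^T *m A.
set ddX := (X in is_derive t 1 dX X) in HdX.
have HV : is_derive t 1 (V \o X) (dotv g (dX t)).
  by rewrite /g -diff_gradient//; exact: is_derive_diff_comp.
have HXs : is_derive t 1 (fun s => X s - Xs) (dX t).
  by have := is_deriveB HX (is_derive_cst Xs t 1); rewrite subr0.
pose U s := b *: (X s - Xs) + al s *: dX s.
have HU : is_derive t 1 U (b *: dX t + (dal *: dX t + al t *: ddX)).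
  exact: is_deriveD (is_deriveZ b HXs) (is_derive_scale Hal HdX).
have HAU : is_derive t 1 (mulmx A \o U)
    (A *m (b *: dX t + (dal *: dX t + al t *: ddX))).
  rewrite -(@diff_mulmx _ _ _ A (U t)); apply: is_derive_diff_comp => //.
  exact: differentiable_mulmx.
have HD := is_derive_dotvv HAU.
have HW : is_derive t 1 (fun s => V (X s) - V Xs) (dotv g (dX t)).
  by have := is_deriveB HV (is_derive_cst (V Xs) t 1); rewrite subr0.
have := is_deriveD (is_deriveM (is_deriveX 2 Hal) HW) (is_deriveZ 2^-1 HD).
move=> H; apply: (is_derive_eq H).
rewrite /= /GRing.scale/= -/(U t).
have -> : b *: dX t + (dal *: dX t + al t *: ddX) =
    (b + dal - al t * (r / t)) *: dX t - al t *: (invmx B *m g).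
  rewrite /ddX scalerBr scalerA mulrN scaleNr !addrA -scalerDl; congr (_ - _).
  by rewrite scalerBl.
rewrite mulmxBr -!scalemxAr [dotv (A *m U t) (_ - _)]dotvDr.
rewrite -(scaleNr (al t) (A *m _)) !dotvZr.
rewrite [dotv (A *m U t) (A *m (invmx B *m g))]dotv_mulmxl mulmxA -/B mulKVmx//.
rewrite /U dotvDl !dotvZl.
rewrite (dotvC (X t - Xs)) (dotvC (dX t)); rewrite exprfctE /=.
by field; rewrite gt_eqF.
Qed.

End energy.

(** * Consequences of full column rank *)

Section gram.
Context {R : realType} {m n : nat}.
Variable A : 'M[R]_(m, n).
Hypothesis rA : \rank A = n.

Lemma gram_unitmx : A^T *m A \in unitmx.
Proof.
rewrite -row_free_unit -kermx_eq0; apply/rowV0P => v /sub_kermxP vB.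
have Av0 : A *m v^T = 0.
  have : dotv (A *m v^T) (A *m v^T) = 0.
    rewrite dotv_mulmxl dotvC /dotv big1// => i _.
    by rewrite mulmxA -[A^T *m A]trmxK trmx_mul trmxK -trmx_mul vB trmx0 mxE mul0r.
  move=> d0; apply/eqP; rewrite -normr_eq0 -[_ == 0](sqrf_eq0 `|A *m v^T|).
  by rewrite eq_le sqr_ge0 andbT -d0 normr_dotvv.
have fA : row_free A^T by rewrite /row_free mxrank_tr rA.
by apply/eqP; rewrite -(mulmx_free_eq0 _ fA) -[v]trmxK -trmx_mul Av0 trmx0.
Qed.

(** [M] is a left inverse of [A], and [K] is the square of a bound on its operator norm. The
    energies see velocities only through [A]; this recovers the vectors themselves. *)
Lemma mulmx_coercive : exists2 K, 0 < K &
  forall u : 'cV[R]_n, `|u| ^+ 2 <= K * dotv (A *m u) (A *m u).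
Proof.
pose M := invmx (A^T *m A) *m A^T.
pose f : {linear 'cV[R]_m -> 'cV[R]_n} := mulmx M.
have /linear_boundedP Mb : bounded_near f (nbhs (0 : 'cV[R]_m)).
  by apply/linear_bounded_continuous; exact: mulmx_continuous.
near (pinfty_nbhs R) => k.
have k0 : 0 < k by near: k; exact: nbhs_pinfty_gt.
have Mk : forall x : 'cV[R]_m, `|M *m x| <= k * `|x|.
  by near: k; exact: Mb.
exists (k ^+ 2) => [|u]; first by rewrite exprn_gt0.
have {1}-> : u = M *m (A *m u).
  by rewrite /M !mulmxA -[_ *m A^T *m A]mulmxA mulVmx ?mul1mx// gram_unitmx.
apply: (@le_trans _ _ ((k * `|A *m u|) ^+ 2)).
  by rewrite ler_pXn2r// nnegrE// mulr_ge0// ltW.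
by rewrite exprMn ler_wpM2l ?sqr_ge0// normr_dotvv.
Unshelve. all: by end_near. Qed.

End gram.

(** * Regularity of the field and decrease of energies *)

Section admm.
Context {R : realType} {m n : nat}.
Variables (A : 'M[R]_(m, n)) (r t0 : R) (V : 'cV[R]_n -> R) (Xs : 'cV[R]_n).
Hypothesis rA : \rank A = n.
Hypothesis t0_gt0 : 0 < t0.
Hypothesis dV : continuously_differentiable V.

Local Notation F := (admm_field A r V).

Lemma admm_field_continuous (y : 'cV[R]_n * 'cV[R]_n) (t : R) : t0 <= t ->
  F p.1 p.2 @[p --> (y, t)] --> F y t.
Proof.
move=> t0t; have [_ cg] := dV.
have c1 : p.1 @[p --> (y, t)] --> y by exact: cvg_fst.
have c2 : p.2 @[p --> (y, t)] --> t by exact: cvg_snd.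
have c11 : p.1.1 @[p --> (y, t)] --> y.1.
  exact: (@cvg_comp _ _ _ (fun p : ('cV[R]_n * 'cV[R]_n) * R => p.1) fst
    _ _ _ c1 cvg_fst).
have c12 : p.1.2 @[p --> (y, t)] --> y.2.
  exact: (@cvg_comp _ _ _ (fun p : ('cV[R]_n * 'cV[R]_n) * R => p.1) snd
    _ _ _ c1 cvg_snd).
have cg1 : gradient V p.1.1 @[p --> (y, t)] --> gradient V y.1.
  exact: (@cvg_comp _ _ _ _ (gradient V) _ _ _ c11 (cg y.1)).
have cB : invmx (A^T *m A) *m gradient V p.1.1 @[p --> (y, t)] -->
    invmx (A^T *m A) *m gradient V y.1.
  have cM := @mulmx_continuous R n n 1 (invmx (A^T *m A)) (gradient V y.1).
  exact: (@cvg_comp _ _ _ _ (mulmx (invmx (A^T *m A))) _ _ _ cg1 cM).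
have ct : - (r / p.2) @[p --> (y, t)] --> - (r / t).
  apply: cvgN; apply: cvgMr; apply: cvgV => //.
  by rewrite gt_eqF// (lt_le_trans t0_gt0).
exact: (cvg_pair c12 (cvgB (cvgZ ct c12) cB)).
Qed.

Lemma forward_itv_nbhs (T : \bar R) t : t0 < t -> (t%:E < T)%E ->
  nbhs t (forward_itv t0 T).
Proof.
move=> t0t tT; have h1 : \forall s \near t, t0 < s by exact: lt_nbhsr.
have h2 : \forall s \near t, (s%:E < T)%E.
  case: T tT => [T| |] //; last by move=> _; near=> s; rewrite ltry.
  rewrite lte_fin => tT; have : \forall s \near t, s < T by exact: lt_nbhsl.
  by apply: filterS => s; rewrite lte_fin.
by apply: filterS2 h1 h2 => s h1 h2; split => //; exact: ltW.
Unshelve. all: by end_near. Qed.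

Lemma energy_nonincreasing (T : \bar R) Y (al dal : R -> R) (b : R) :
  solution F t0 T Y -> (forall t : R, is_derive t 1 al (dal t)) ->
  (forall t, t0 < t -> forall x v,
     2 * al t * dal t * (V x - V Xs)
     - al t * b * dotv (gradient V x) (x - Xs)
     + (b + dal t - al t * (r / t)) *
       dotv (A *m (b *: (x - Xs) + al t *: v)) (A *m v) <= 0) ->
  forall s t, t0 <= s -> s <= t -> (t%:E < T)%E ->
  energy A V Xs (al t) b (Y t) <= energy A V Xs (al s) b (Y s).
Proof.
move=> sY dal_ neg s t t0s st tT.
have [V' cg] := dV.
have cV : continuous V by move=> x; exact: differentiable_continuous.
have /has_derivative_on_pair[sX sdX] := sY.
have DL u : u \in `]s, t[%R ->
    is_derive u 1 (fun u => energy A V Xs (al u) b (Y u))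
     (2 * al u * dal u * (V (Y u).1 - V Xs)
     - al u * b * dotv (gradient V (Y u).1) ((Y u).1 - Xs)
     + (b + dal u - al u * (r / u)) *
       dotv (A *m (b *: ((Y u).1 - Xs) + al u *: (Y u).2)) (A *m (Y u).2)).
  rewrite in_itv/= => /andP[su ut].
  have t0u : t0 < u by exact: le_lt_trans su.
  have uT : (u%:E < T)%E by apply: lt_trans tT; rewrite lte_fin.
  have nu := forward_itv_nbhs t0u uT.
  have D1 := has_derivative_on_is_derive sX nu.
  have D2 := has_derivative_on_is_derive sdX nu.
  have := @energy_is_derive R m n A V Xs _ _ al (dal u) b r u (gram_unitmx rA)
    (lt_trans t0_gt0 t0u) (V' _) D1 D2 (dal_ u).
  congr is_derive; apply/funext => w; by case: (Y w).
apply: (@ler0_derive1_le_cc _ (fun u => energy A V Xs (al u) b (Y u)) s t) => //.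
- by move=> u /DL[].
- move=> u us; rewrite derive1E; have [_ ->] := DL u us.
  apply: neg; move: us; rewrite in_itv/= => /andP[su _]; exact: le_lt_trans su.
- apply/subspace_continuousP => u; rewrite /= in_itv/= => /andP[su ut].
  apply: energy_cvg => //.
    apply: cvg_within_filter; apply: differentiable_continuous.
    by apply/derivable1_diffP; have [] := dal_ u.
  have Du : forward_itv t0 T u.
    by split; [exact: le_trans su|apply: le_lt_trans tT; rewrite lee_fin].
  apply: cvg_trans (has_derivative_on_continuous sY Du).
  apply: cvg_app; apply: within_subset => w /=; rewrite in_itv/= => /andP[sw wt].
  by split; [exact: le_trans sw|apply: le_lt_trans tT; rewrite lee_fin].
- by rewrite in_itv/= st lexx.
- by rewrite in_itv/= st lexx.
Qed.

End admm.

(** * Stability, global existence and convergence *)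

Section stability.
Context {R : realType} {m n : nat}.
Variables (A : 'M[R]_(m, n)) (r t0 : R) (V : 'cV[R]_n -> R) (Xs : 'cV[R]_n).
Hypothesis rA : \rank A = n.
Hypothesis r3 : 3 <= r.
Hypothesis t0_gt0 : 0 < t0.
Hypothesis dV : continuously_differentiable V.
Hypothesis convV : convex_function (E := 'cV[R]_n) [set: 'cV[R]_n] V.
Hypothesis minV : forall y, V Xs <= V y.
Hypothesis sublevelV : forall rho : R, 0 < rho -> exists2 e : R, 0 < e &
  forall y, V y - V Xs < e -> `|y - Xs| < rho.

Local Notation F := (admm_field A r V).
Local Notation W := (energy A V Xs 1 0).

Lemma gradientV_eq0 : gradient V Xs = 0.
Proof. by apply: gradient_minimizer minV; case: dV. Qed.

Lemma admm_critical_point : critical_point F t0 (Xs, 0).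
Proof.
by move=> t _; rewrite /admm_field /= gradientV_eq0 mulmx0 scaler0 subr0.
Qed.

Lemma energy_ge0 a b y : 0 <= energy A V Xs a b y.
Proof.
rewrite /energy addr_ge0// mulr_ge0 ?sqr_ge0 ?subr_ge0 ?invr_ge0//.
exact: dotvv_ge0.
Qed.

Lemma energy_small_near rho : 0 < rho -> exists2 e : R, 0 < e &
  forall y, W y < e -> `|y.1 - Xs| < rho /\ `|y.2| < rho.
Proof.
move=> rho0; have [e1 e10 He1] := sublevelV rho0.
have [K K0 HK] := mulmx_coercive rA.
(* The final halving matches the factor 1/2 of the kinetic term. *)
have e20 : 0 < rho ^+ 2 / K / 2 by rewrite !divr_gt0// exprn_gt0.
exists (Num.min e1 (rho ^+ 2 / K / 2)); first by rewrite lt_min e10.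
move=> y; rewrite lt_min /energy expr1n mul1r scale0r add0r scale1r => /andP[Wy1 Wy2].
have d0 := dotvv_ge0 (A *m y.2); have V0 : 0 <= V y.1 - V Xs by rewrite subr_ge0.
split; first by apply: He1; lra.
rewrite -(ltr_pXn2r (n := 2))// ?nnegrE// ?(ltW rho0)//.
apply: le_lt_trans (HK _) _; rewrite mulrC -ltr_pdivlMr//; lra.
Qed.

Lemma nbhs_energy_lt e : 0 < e -> nbhs (Xs, 0 : 'cV[R]_n) [set y | W y < e].
Proof.
move=> e0; have cV : continuous V.
  by move=> x; apply: differentiable_continuous; case: dV.
have : W y @[y --> (Xs, 0 : 'cV[R]_n)] --> W (Xs, 0).
  by apply: energy_cvg => //; exact: cvg_cst.
have -> : W (Xs, 0) = 0.
  rewrite /energy /= !subrr !scaler0 addr0 mulmx0 mulr0 add0r.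
  by rewrite /dotv big1 ?mulr0// => i _; rewrite mxE mul0r.
by move=> cW; exact: (cvgr_lt _ cW).
Qed.

(** With [b = 0] and a constant weight, only the friction term is left in the derivative. *)
Lemma W_nonincreasing T Y : solution F t0 T Y ->
  forall t, forward_itv t0 T t -> W (Y t) <= W (Y t0).
Proof.
move=> sY t [t0t tT].
have D (u : R) : is_derive u 1 (cst 1 : R -> R) (cst 0 u : R).
  exact: is_derive_cst.
apply: (energy_nonincreasing rA t0_gt0 dV sY D) => // u u0 x v /=.
rewrite scale0r add0r scale1r mulr0 mul0r !mul1r mul0r subrr !add0r.
have r0 : 0 <= r by exact: le_trans r3.
by rewrite mulNr oppr_le0 mulr_ge0 ?dotvv_ge0// divr_ge0// ltW// (lt_trans t0_gt0).
Qed.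

(** [b = r - 1] makes the velocity coefficient [b + 1 - r] vanish, and the gradient inequality
    bounds what remains by [- t (r - 3) (V x - V Xs)], whence the threshold 3. *)
Lemma rescaled_energy_nonincreasing T Y : solution F t0 T Y ->
  forall t, forward_itv t0 T t ->
  energy A V Xs t (r - 1) (Y t) <= energy A V Xs t0 (r - 1) (Y t0).
Proof.
move=> sY t [t0t tT].
have D (u : R) : is_derive u 1 (id : R -> R) (cst 1 u : R).
  exact: is_derive_id.
apply: (energy_nonincreasing rA t0_gt0 dV sY D) => // u u0 x v /=.
have u_gt0 := lt_trans t0_gt0 u0.
have -> : r - 1 + 1 - u * (r / u) = 0 by field; rewrite gt_eqF.
rewrite mul0r addr0.
have [V' _] := dV.
have := convex_derive Xs convV (V' x).
rewrite diff_gradient// -opprB -scaleN1r dotvZr => cx.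
have V0 := minV x; have r3' := r3.
set d := dotv _ _ in cx *.
have : u * (r - 1) * (V x - V Xs) <= u * (r - 1) * d.
  by rewrite ler_wpM2l//; [apply: mulr_ge0; [exact: ltW|lra]|lra].
have : 0 <= u * ((r - 3) * (V x - V Xs)).
  by apply: mulr_ge0; [exact: ltW|apply: mulr_ge0; lra].
by lra.
Qed.

Lemma admm_asymptotically_stable : asymptotically_stable F t0 (Xs, 0).
Proof.
have r3' := r3.
suff H N : nbhs (Xs, 0 : 'cV[R]_n) N -> exists N0,
    [/\ nbhs (Xs, 0 : 'cV[R]_n) N0,
    N0 `<=` N, solutions_remain F t0 N0 N & solutions_converge F t0 N0 (Xs, 0)].
  by split=> // N /H[N0 [? ? ? _]]; exists N0.
move=> /nbhs_ballP[rho0 /= rho0_gt0 HN].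
have [V' cg] := dV.
pose P := invmx (A^T *m A).
have [rho1 rho1_gt0 Hrho1] : exists2 rho1 : R, 0 < rho1 &
    forall x, `|x - Xs| < rho1 -> `|P *m gradient V x| < 1.
  have cM := @mulmx_continuous R n n 1 P (gradient V Xs).
  have := @cvg_comp _ _ _ (gradient V) (mulmx P) _ _ _ (cg Xs) cM.
  rewrite gradientV_eq0 mulmx0 => /cvgr0_norm_lt/(_ 1 ltr01)/nbhs_ballP[d /= d0 Hd].
  by exists d => // x xd; apply: Hd; rewrite -ball_normE /ball_ /= distrC.
(* [rho0] keeps the state in [N], [rho1] keeps the force below 1, and 1 bounds the position offset
   and the velocity. *)
pose rho := Num.min (Num.min rho0 rho1) 1.
have rho_gt0 : 0 < rho by rewrite !lt_min rho0_gt0 rho1_gt0 ltr01.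
have [e e0 He] := energy_small_near rho_gt0.
have good y : W y < e ->
    [/\ N y, `|P *m gradient V y.1| < 1, `|y.1 - Xs| < 1 & `|y.2| < 1].
  move=> /He[]; rewrite !lt_min => /andP[/andP[a1 a2] a3] /andP[/andP[b1 b2] b3].
  split=> //; last exact: Hrho1.
  apply: HN; split; rewrite -ball_normE /ball_ /= distrC//.
  by rewrite subr0.
have stay T Y : maximal_solution F t0 T Y -> W (Y t0) < e ->
    forall t, forward_itv t0 T t -> W (Y t) < e.
  by move=> [_ sY _] We t Dt; exact: le_lt_trans (W_nonincreasing sY Dt) We.
have global T Y : maximal_solution F t0 T Y -> W (Y t0) < e -> T = +oo%E.
  move=> mY We; apply: (@maximal_solution_pinfty _ _ F t0 T Y (r / t0 + 1)) => //.
  - by move=> C; apply: compact_prod_ball; exact: compact_cV_ball.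
  - by move=> y t; exact: admm_field_continuous.
  move=> t Dt; have [_ g1 _ y1] := good _ (stay _ _ mY We t Dt).
  case: Dt => t0t _; have tt0 := lt_le_trans t0_gt0 t0t.
  have rt : 0 <= r / t by rewrite divr_ge0 ?(ltW tt0)//; lra.
  have rt0 : r / t <= r / t0 by rewrite ler_wpM2l ?lef_pV2 ?posrE//; lra.
  rewrite prod_normE ge_max /admm_field /=; apply/andP; split; first lra.
  rewrite (le_trans (ler_normB _ _))// lerD ?(ltW g1)//.
  rewrite normrZ normrN ger0_norm// (le_trans _ rt0)//.
  by rewrite ler_piMr// ltW.
exists [set y | W y < e]; split.
- exact: nbhs_energy_lt.
- by move=> y /good[].
- move=> T Y mY We; have Too := global T Y mY We; split=> // t t0t.
  have [] // := good _ (stay _ _ mY We t _).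
  by split; [exact: ltW|rewrite Too ltry].
move=> T Y mY We; have Too := global T Y mY We.
have Dt t : t0 <= t -> forward_itv t0 T t by move=> ?; split => //; rewrite Too ltry.
have [_ sY _] := mY.
set C := energy A V Xs t0 (r - 1) (Y t0).
have C0 : 0 <= C := energy_ge0 _ _ _.
have [K K0 HK] := mulmx_coercive rA.
(* The scaled velocity is [u - (r - 1) *: (X - Xs)] with [X] already confined to distance 1;
   [1 + |u|^2] serves as a bound on [|u|] that avoids a square root. *)
have LC t : t0 <= t -> t ^+ 2 * (V (Y t).1 - V Xs) <= C /\
    `|t *: (Y t).2| <= (1 + K * (2 * C)) + (r - 1).
  move=> t0t; have := rescaled_energy_nonincreasing sY (Dt t t0t).
  rewrite -/C /energy; set u := (_ *: _ + _) => Hu.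
  have d0 := dotvv_ge0 (A *m u).
  have V0 : 0 <= t ^+ 2 * (V (Y t).1 - V Xs) by rewrite mulr_ge0 ?sqr_ge0// subr_ge0.
  split; first lra.
  have u2 : `|u| ^+ 2 <= K * (2 * C).
    by rewrite (le_trans (HK u))// ler_wpM2l ?(ltW K0)//; lra.
  have -> : t *: (Y t).2 = u - (r - 1) *: ((Y t).1 - Xs).
    by rewrite /u addrAC subrr add0r.
  have [_ _ X1 _] := good _ (stay _ _ mY We t (Dt t t0t)).
  rewrite (le_trans (ler_normB _ _))// lerD//.
    by have := normr_ge0 u; nra.
  by rewrite normrZ ger0_norm; [rewrite ler_piMr ?(ltW X1)//|]; lra.
pose C2 := (1 + K * (2 * C)) + (r - 1).
apply/cvgrPdist_lt => d d0.
have [e' e'0 He'] := sublevelV d0.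
near=> t.
have t0t : t0 <= t by near: t; apply: nbhs_pinfty_ge; exact: num_real.
(* Ensures [t <= t ^+ 2], so that [C / e' < t] is enough to bring the gap below [e']. *)
have t1 : 1 <= t by near: t; apply: nbhs_pinfty_ge; exact: num_real.
have tC : C / e' < t by near: t; apply: nbhs_pinfty_gt; exact: num_real.
have tC2 : C2 / d < t by near: t; apply: nbhs_pinfty_gt; exact: num_real.
have [L1 L2] := LC t t0t.
rewrite prod_normE gt_max /= distrC sub0r normrN; apply/andP; split.
  apply: He'; rewrite -(ltr_pM2l (x := t ^+ 2)) ?exprn_gt0 ?(lt_le_trans ltr01)//.
  apply: le_lt_trans L1 _; move: tC; rewrite ltr_pdivrMr// => /lt_le_trans; apply.
  by rewrite ler_pM2r// expr2 ler_peMr// (le_trans _ t1).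
have tp := lt_le_trans (@ltr01 R) t1.
move: L2; rewrite normrZ gtr0_norm// -/C2 => L2.
rewrite -(ltr_pM2l tp); apply: le_lt_trans L2 _.
by move: tC2; rewrite ltr_pdivrMr.
Unshelve. all: by end_near. Qed.

Lemma admm_solution_flow T (X dX : R -> 'cV[R]_n) :
  solution F t0 T (fun t => (X t, dX t)) <-> admm_flow A r V t0 T X dX.
Proof.
split=> [/has_derivative_on_pair[HX HdX]|[HX [ddX [HdX Hdd]]]].
  split=> //; eexists; split; first exact: HdX.
  by move=> t _ /=; rewrite scaleNr addrAC subrK addNr.
apply/has_derivative_on_pair; split => // t Dt /=.
rewrite (_ : - (r / t) *: dX t - _ = ddX t); first exact: HdX.
apply/esym/eqP; rewrite -subr_eq0 scaleNr opprD !opprK addrA.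
by rewrite Hdd.
Qed.

End stability.
Theorem theorem10 (R : realType) (m n : nat)
    (f : 'cV[R]_n -> R) (g : 'cV[R]_m -> R) (A : 'M[R]_(m, n))
    (r t0 : R) (O : set 'cV[R]_n) (Xs : 'cV[R]_n) (phi : R -> R)
    (V := fun x : 'cV[R]_n => f x + g (A *m x)) :
  continuously_differentiable f ->
  continuously_differentiable g ->
  convex_function (E := 'cV[R]_n) [set: 'cV[R]_n] f ->
  convex_function (E := 'cV[R]_m) [set: 'cV[R]_m] g ->
  (n <= m)%N ->
  \rank A = n ->
  3 <= r ->
  0 < t0 ->
  argmin V !=set0 ->
  open O ->
  O Xs ->
  local_minimizer V Xs ->
  forcing_function phi ->
  (forall X, O X -> phi (enorm (X - Xs)) <= V X - V Xs) ->
  [/\ critical_point (admm_field A r V) t0 (Xs, 0),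
      asymptotically_stable (admm_field A r V) t0 (Xs, 0) &
      forall (T : \bar R) (X dX : R -> 'cV[R]_n),
        solution (admm_field A r V) t0 T (fun t => (X t, dX t)) <->
        admm_flow A r V t0 T X dX].

move=> cf cg convf convg _ rA r3 t0_gt0 _ oO OXs lmin force HO.
have dV : continuously_differentiable V by exact: continuously_differentiable_comp.
have convV : convex_function (E := 'cV[R]_n) [set: 'cV[R]_n] V.
  exact: convex_function_comp.
have minV := convex_local_minimizer convV lmin.
have sublevelV := forcing_sublevel convV minV oO OXs force HO.
split.
- exact: admm_critical_point.
- exact: admm_asymptotically_stable.
- move=> T X dX; exact: admm_solution_flow.
Qed.
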